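(* Let $u,v$ be complex numbers such that: - $u$ is a complex (non-real) root of a monic irreducible polynomial $p(z)$ of degree $n$ with integer coefficients, all of whose $n-2$ real roots $r_1,\dots,r_{n-2}$ (that is, $p$ has exactly $n-2$ real roots) lie in the interval $(-1,1)$; - $v$ is an algebraic integer in $\mathbb{Q}(u)$, with $v^2\neq1$; - for each real embedding $\sigma_i:\mathbb{Q}(u)\to\mathbb{R}$, $\sigma_i|_{\mathbb{Q}}=\mathrm{id}$, defined by $\sigma_i(u)=r_i$, the image $\sigma_i(v)$ lies in $(-1,1)$. Then a group $\mathcal{G}$ of elements of norm $1$ in an order of the quaternion algebra $$\mathcal{Q}_{\mathbb{Q}}=\left(\frac{u^2-1,\;v^2-1}{\mathbb{Q}(u,v)}\right)$$ is a discrete subgroup of an arithmetic Kleinian group.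
   Context: $\left(\frac{a,b}{k}\right)$ is the quaternion algebra over $k$ with basis $1,\mathbf{i},\mathbf{j},\mathbf{k}$, $\mathbf{i}^2=a$, $\mathbf{j}^2=b$, $\mathbf{i}\mathbf{j}=-\mathbf{j}\mathbf{i}=\mathbf{k}$. For a number field $k$, an order in a quaternion algebra $Q$ over $k$ is a finitely generated module over the ring of integers of $k$ which spans $Q$ over $k$ and is a ring with $1$. The group $\mathcal{G}$ is regarded as a subgroup of $SL(2,\mathbb{C})$ (or $PSL(2,\mathbb{C})$) via an embedding $Q\to M_2(\mathbb{C})$ extending the inclusion $k\subset\mathbb{C}$. Arithmetic Kleinian group: let $k$ be a number field with exactly one complex place, $Q$ a quaternion algebra over $k$ ramified at all real places, $\rho$ an embedding of $Q$ into $M_2(\mathbb{C})$, $O$ an order of $Q$, $O_1$ its elements of norm $1$. Then the projection of $\rho(O_1)$ to $PSL(2,\mathbb{C})$ is a Kleinian group; the Kleinian groups so constructed, together with those commensurable to them, are called arithmetic. *)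

(* Defs.v *)
From HB Require Import structures.
From mathcomp Require Import all_boot all_order all_algebra.
From mathcomp Require Import generic_quotient complex ring.
From mathcomp Require Import all_classical all_reals all_analysis.

Set Implicit Arguments.
Unset Strict Implicit.
Unset Printing Implicit Defensive.

Import Order.TTheory GRing.Theory Num.Theory.
Import numFieldNormedType.Exports.

Local Open Scope classical_set_scope.
Local Open Scope ring_scope.
Local Open Scope quotient_scope.

Section GeneratedSubfield.
Variables (F : fieldType) (s : seq F).

(* Over a field F of characteristic 0 this is Q(s), since the prime field lies
   in every subfield. *)
Definition adjoin : {pred F} := fun z =>
  `[< forall S : {pred F}, divring_closed S -> {subset s <= S} -> z \in S >].

Lemma adjoin_closed : divring_closed adjoin.
Proof.
split.
- by apply/asboolP => S [].
- move=> x y /asboolP hx /asboolP hy; apply/asboolP => S cS sS.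
  by have [_ sub _] := cS; apply: sub; [exact: hx | exact: hy].
- move=> x y /asboolP hx /asboolP hy; apply/asboolP => S cS sS.
  by have [_ _ dv] := cS; apply: dv; [exact: hx | exact: hy].
Qed.

Lemma mem_adjoin_nth (i : 'I_(size s)) : s`_i \in adjoin.
Proof. by apply/asboolP => S _; apply; exact: mem_nth. Qed.

HB.instance Definition _ :=
  GRing.isDivringClosed.Build F adjoin adjoin_closed.

Record adjoin_field := AdjoinField {
  adjoin_val :> F;
  adjoin_valP : adjoin_val \in adjoin
}.

HB.instance Definition _ := [isSub for adjoin_val].
HB.instance Definition _ := [Choice of adjoin_field by <:].
HB.instance Definition _ :=
  [SubChoice_isSubIntegralDomain of adjoin_field by <:].
HB.instance Definition _ :=
  [SubIntegralDomain_isSubField of adjoin_field by <:].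

Definition adjoin_gen (i : 'I_(size s)) : adjoin_field :=
  AdjoinField (mem_adjoin_nth i).

End GeneratedSubfield.

Arguments adjoin_val {F} s _.
Arguments adjoin_gen {F} s i.

(* Quat x0 x1 x2 x3 is x0 + x1 i + x2 j + x3 ij, where i^2 = a, j^2 = b and
   ij = - ji; hence (ij)^2 = - ab. The parameters a and b do not occur in the
   fields: they select the multiplication put on the type below. *)
Record quat (k : fieldType) (a b : k) :=
  Quat { qre : k; qi : k; qj : k; qk : k }.
Arguments quat {k} a b.
Arguments Quat {k a b} _ _ _ _.

Section Quaternion.
Variables (k : fieldType) (a b : k).
Local Notation Q := (quat a b).

Definition quat_tuple (x : Q) := (qre x, qi x, qj x, qk x).
Definition tuple_quat (t : k * k * k * k) : Q :=
  let: (x0, x1, x2, x3) := t in Quat x0 x1 x2 x3.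
Lemma quat_tupleK : cancel quat_tuple tuple_quat.
Proof. by case. Qed.

HB.instance Definition _ := Choice.copy Q (can_type quat_tupleK).

Definition addq (x y : Q) : Q :=
  Quat (qre x + qre y) (qi x + qi y) (qj x + qj y) (qk x + qk y).
Definition oppq (x : Q) : Q := Quat (- qre x) (- qi x) (- qj x) (- qk x).
Definition mulq (x y : Q) : Q := Quat
  (qre x * qre y + a * (qi x * qi y) + b * (qj x * qj y)
     - a * b * (qk x * qk y))
  (qre x * qi y + qi x * qre y + b * (qk x * qj y) - b * (qj x * qk y))
  (qre x * qj y + qj x * qre y + a * (qi x * qk y) - a * (qk x * qi y))
  (qre x * qk y + qk x * qre y + qi x * qj y - qj x * qi y).
Definition scaleq (c : k) (x : Q) : Q :=
  Quat (c * qre x) (c * qi x) (c * qj x) (c * qk x).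
Definition oneq : Q := Quat 1 0 0 0.

Fact addqA : associative addq.
Proof. by move=> x y z; rewrite /addq /= !addrA. Qed.
Fact addqC : commutative addq.
Proof. by move=> x y; congr Quat; rewrite addrC. Qed.
Fact add0q : left_id (Quat 0 0 0 0) addq.
Proof. by case=> *; rewrite /addq /= !add0r. Qed.
Fact addNq : left_inverse (Quat 0 0 0 0) oppq addq.
Proof. by case=> *; rewrite /addq /= !addNr. Qed.

HB.instance Definition _ := GRing.isZmodule.Build Q addqA addqC add0q addNq.

Fact mulqA : associative mulq.
Proof. by case=> ? ? ? ? [? ? ? ?] [? ? ? ?]; congr Quat => /=; ring. Qed.
Fact mul1q : left_id oneq mulq.
Proof. by case=> ? ? ? ?; congr Quat => /=; ring. Qed.
Fact mulq1 : right_id oneq mulq.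
Proof. by case=> ? ? ? ?; congr Quat => /=; ring. Qed.
Fact mulqDl : left_distributive mulq addq.
Proof. by case=> ? ? ? ? [? ? ? ?] [? ? ? ?]; congr Quat => /=; ring. Qed.
Fact mulqDr : right_distributive mulq addq.
Proof. by case=> ? ? ? ? [? ? ? ?] [? ? ? ?]; congr Quat => /=; ring. Qed.
Fact oneq_neq0 : oneq != 0 :> Q.
Proof. by apply/eqP => -[] /eqP; rewrite oner_eq0. Qed.

HB.instance Definition _ :=
  GRing.Zmodule_isNzRing.Build Q mulqA mul1q mulq1 mulqDl mulqDr oneq_neq0.

Fact scaleqA c d (x : Q) : scaleq c (scaleq d x) = scaleq (c * d) x.
Proof. by rewrite /scaleq /= !mulrA. Qed.
Fact scale1q : left_id 1 scaleq.
Proof. by case=> *; rewrite /scaleq /= !mul1r. Qed.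
Fact scaleqDr : right_distributive scaleq +%R.
Proof. by move=> c [? ? ? ?] [? ? ? ?]; congr Quat => /=; ring. Qed.
Fact scaleqDl (x : Q) : {morph scaleq^~ x : c d / c + d}.
Proof. by case: x => ? ? ? ? c d; congr Quat => /=; ring. Qed.

HB.instance Definition _ :=
  GRing.Zmodule_isLmodule.Build k Q scaleqA scale1q scaleqDr scaleqDl.

Fact scaleqAl (c : k) (x y : Q) : c *: (x * y) = (c *: x) * y.
Proof. by case: x y => ? ? ? ? [? ? ? ?]; congr Quat => /=; ring. Qed.
HB.instance Definition _ := GRing.Lmodule_isLalgebra.Build k Q scaleqAl.

Fact scaleqAr (c : k) (x y : Q) : c *: (x * y) = x * (c *: y).
Proof. by case: x y => ? ? ? ? [? ? ? ?]; congr Quat => /=; ring. Qed.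
HB.instance Definition _ := GRing.Lalgebra_isAlgebra.Build k Q scaleqAr.

Lemma quat_ii : Quat 0 1 0 0 * Quat 0 1 0 0 = a%:A :> Q.
Proof. by congr Quat => /=; ring. Qed.
Lemma quat_jj : Quat 0 0 1 0 * Quat 0 0 1 0 = b%:A :> Q.
Proof. by congr Quat => /=; ring. Qed.
Lemma quat_ij : Quat 0 1 0 0 * Quat 0 0 1 0 = Quat 0 0 0 1 :> Q.
Proof. by congr Quat => /=; ring. Qed.
Lemma quat_ji : Quat 0 0 1 0 * Quat 0 1 0 0 = - Quat 0 0 0 1 :> Q.
Proof. by congr Quat => /=; ring. Qed.

Definition conjq (x : Q) : Q := Quat (qre x) (- qi x) (- qj x) (- qk x).
Definition nrd (x : Q) : k :=
  qre x ^+ 2 - a * qi x ^+ 2 - b * qj x ^+ 2 + a * b * qk x ^+ 2.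

Lemma nrdE (x : Q) : x * conjq x = (nrd x)%:A.
Proof. by case: x => ? ? ? ?; congr Quat; rewrite /nrd /=; ring. Qed.

(* The finite sums in the first clause range over the whole O_k-module
   generated by the e i, where O_k is the ring of integers of k. *)
Definition is_order (O : set Q) : Prop :=
  [/\ exists (m : nat) (e : 'I_m -> Q),
        O = [set x | exists c : 'I_m -> k,
               (forall i, integralOver (intr : int -> k) (c i))
               /\ x = \sum_i c i *: e i],
      forall x, exists (m : nat) (c : 'I_m -> k) (y : 'I_m -> Q),
        (forall i, O (y i)) /\ x = \sum_i c i *: y i,
      O 1
    & forall x y, O x -> O y -> O (x * y)].

Definition norm_one (O : set Q) : set Q := [set x | O x /\ nrd x = 1].

(* Subsets of the multiplicative monoid that are groups with identity 1. *)
Definition mul_group (G : set Q) : Prop :=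
  [/\ G 1, forall x y, G x -> G y -> G (x * y)
    & forall x, G x -> exists2 y, G y & x * y = 1 /\ y * x = 1].

End Quaternion.

(* For a field embedding sigma : k -> K, the base change of (a, b / k) to K is
   (sigma a, sigma b / K); ramification at a real place means that it is a
   division algebra. *)
Definition ramified_at (k K : fieldType) (sigma : {rmorphism k -> K})
    (a b : k) : Prop :=
  forall x : quat (sigma a) (sigma b), x != 0 ->
    exists y, x * y = 1 /\ y * x = 1.

Definition number_field (k : fieldType) : Prop :=
  [pchar k] =i pred0 /\
  exists (m : nat) (e : 'I_m -> k),
    forall x, exists c : 'I_m -> rat, x = \sum_i ratr (c i) * e i.

Section Arithmetic.
Variable R : realType.
Local Notation C := R[i].

Definition complex_embedding (k : fieldType) (tau : {rmorphism k -> C}) :=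
  exists x, tau x \isn't Num.real.

(* A complex place is a pair of conjugate non-real embeddings. *)
Definition one_complex_place (k : fieldType) : Prop :=
  exists2 tau : {rmorphism k -> C}, complex_embedding tau &
    forall tau' : {rmorphism k -> C}, complex_embedding tau' ->
      tau' =1 tau \/ (forall x, tau' x = (tau x)^*).

Record SL2 := MkSL2 {
  sl2_val :> 'M[C]_2;
  sl2_valP : \det sl2_val == 1
}.

HB.instance Definition _ := [isSub for sl2_val].
HB.instance Definition _ := [Choice of SL2 by <:].
(* The subspace topology; the alias C^o carries the topology of the norm. *)
HB.instance Definition _ :=
  Topological.copy SL2 (initial_topology (sl2_val : SL2 -> 'M[C^o]_2)).

Fact sl2_one_subproof : \det (1%:M : 'M[C]_2) == 1.
Proof. by rewrite det1. Qed.
Fact sl2_mul_subproof (A B : SL2) : \det ((A : 'M[C]_2) *m B) == 1.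
Proof. by rewrite det_mulmx (eqP (sl2_valP A)) (eqP (sl2_valP B)) mulr1. Qed.
Fact sl2_inv_subproof (A : SL2) : \det (invmx (A : 'M[C]_2)) == 1.
Proof. by rewrite det_inv (eqP (sl2_valP A)) invr1. Qed.

Definition sl2_one := MkSL2 sl2_one_subproof.
Definition sl2_mul A B := MkSL2 (sl2_mul_subproof A B).
Definition sl2_inv A := MkSL2 (sl2_inv_subproof A).

Fact sl2_unitmx (A : SL2) : (A : 'M[C]_2) \in unitmx.
Proof. by rewrite unitmxE (eqP (sl2_valP A)) unitr1. Qed.
Fact sl2_mulA : associative sl2_mul.
Proof. by move=> A B D; apply: val_inj; exact: mulmxA. Qed.
Fact sl2_mul1 : left_id sl2_one sl2_mul.
Proof. by move=> A; apply: val_inj; exact: mul1mx. Qed.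
Fact sl2_1mul : right_id sl2_one sl2_mul.
Proof. by move=> A; apply: val_inj; exact: mulmx1. Qed.
Fact sl2_mulV : left_inverse sl2_one sl2_inv sl2_mul.
Proof. by move=> A; apply: val_inj; exact: mulVmx (sl2_unitmx A). Qed.
Fact sl2_Vmul : right_inverse sl2_one sl2_inv sl2_mul.
Proof. by move=> A; apply: val_inj; exact: mulmxV (sl2_unitmx A). Qed.

HB.instance Definition _ :=
  isGroup.Build SL2 sl2_mulA sl2_mul1 sl2_1mul sl2_mulV sl2_Vmul.

Definition psl2_rel (A B : SL2) : bool :=
  ((A : 'M[C]_2) == B) || ((A : 'M[C]_2) == - (B : 'M[C]_2)).

Fact psl2_rel_refl : reflexive psl2_rel.
Proof. by move=> A; rewrite /psl2_rel eqxx. Qed.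
Fact psl2_rel_sym : symmetric psl2_rel.
Proof. by move=> A B; rewrite /psl2_rel eq_sym -eqr_oppLR (eq_sym _ (B : 'M[C]_2)). Qed.
Fact psl2_rel_trans : transitive psl2_rel.
Proof.
move=> B A D; rewrite /psl2_rel.
by move=> /orP[] /eqP -> /orP[] /eqP ->; rewrite ?opprK ?eqxx ?orbT.
Qed.

Canonical psl2_equiv := EquivRel psl2_rel psl2_rel_refl psl2_rel_sym psl2_rel_trans.

Definition PSL2 := quotient_topology {eq_quot psl2_equiv}.

HB.instance Definition _ := Choice.on PSL2.
HB.instance Definition _ := Quotient.on PSL2.
HB.instance Definition _ := Topological.on PSL2.

Definition psl2_proj : SL2 -> PSL2 := \pi_PSL2.

Definition psl2_one : PSL2 := psl2_proj 1%g.
Definition psl2_mul (g h : PSL2) : PSL2 := psl2_proj (repr g * repr h)%g.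
Definition psl2_inv (g : PSL2) : PSL2 := psl2_proj (repr g)^-1%g.

Lemma psl2_projP (A B : SL2) : reflect (psl2_proj A = psl2_proj B) (psl2_rel A B).
Proof. exact: (eqmodP psl2_equiv A B). Qed.

Lemma psl2_mulE (A B : SL2) :
  psl2_mul (psl2_proj A) (psl2_proj B) = psl2_proj (A * B)%g.
Proof.
apply/psl2_projP.
have /psl2_projP/orP hA : psl2_proj (repr (psl2_proj A)) = psl2_proj A.
  exact: reprK.
have /psl2_projP/orP hB : psl2_proj (repr (psl2_proj B)) = psl2_proj B.
  exact: reprK.
rewrite /psl2_rel /=; case: hA => /eqP ->; case: hB => /eqP ->;
by rewrite ?mulNmx ?mulmxN ?opprK eqxx ?orbT.
Qed.

Lemma psl2_invE (A : SL2) : psl2_inv (psl2_proj A) = psl2_proj A^-1%g.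
Proof.
apply/psl2_projP.
have /psl2_projP/orP hA : psl2_proj (repr (psl2_proj A)) = psl2_proj A.
  exact: reprK.
rewrite /psl2_rel /=; case: hA => /eqP ->; first by rewrite eqxx.
have AU := sl2_unitmx A.
have NAU : - (A : 'M[C]_2) \in unitmx by rewrite -scaleN1r unitmxZ ?unitrN1.
suff -> : invmx (- (A : 'M[C]_2)) = - invmx (A : 'M[C]_2) by rewrite eqxx orbT.
by apply: (can_inj (mulKmx NAU)); rewrite mulmxV // mulNmx mulmxN opprK mulmxV.
Qed.

Lemma psl2_ind (P : PSL2 -> Prop) : (forall A, P (psl2_proj A)) -> forall g, P g.
Proof. by move=> h g; have := h (repr g); rewrite /psl2_proj reprK. Qed.

Fact psl2_mulA : associative psl2_mul.
Proof.
elim/psl2_ind=> A; elim/psl2_ind=> B; elim/psl2_ind=> D.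
by rewrite !psl2_mulE mulgA.
Qed.
Fact psl2_mul1 : left_id psl2_one psl2_mul.
Proof. by elim/psl2_ind=> A; rewrite psl2_mulE mul1g. Qed.
Fact psl2_1mul : right_id psl2_one psl2_mul.
Proof. by elim/psl2_ind=> A; rewrite psl2_mulE mulg1. Qed.
Fact psl2_mulV : left_inverse psl2_one psl2_inv psl2_mul.
Proof. by elim/psl2_ind=> A; rewrite psl2_invE psl2_mulE mulVg. Qed.
Fact psl2_Vmul : right_inverse psl2_one psl2_inv psl2_mul.
Proof. by elim/psl2_ind=> A; rewrite psl2_invE psl2_mulE mulgV. Qed.

HB.instance Definition _ :=
  isGroup.Build PSL2 psl2_mulA psl2_mul1 psl2_1mul psl2_mulV psl2_Vmul.

Definition is_subgroup (gT : groupType) (H : set gT) : Prop :=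
  H 1%g /\ forall x y, H x -> H y -> H (x * y^-1)%g.

Definition finite_index (gT : groupType) (H K : set gT) : Prop :=
  finite_set [set [set (g * h)%g | h in H] | g in K].

Definition commensurable (gT : groupType) (H K : set gT) : Prop :=
  finite_index (H `&` K) H /\ finite_index (H `&` K) K.

(* The induced topology on H is discrete. *)
Definition discrete_subset (T : topologicalType) (H : set T) : Prop :=
  H `<=` isolated H.

Definition kleinian (H : set PSL2) : Prop :=
  is_subgroup H /\ discrete_subset H.

Definition extends_embedding (k : fieldType) (a b : k) (tau : k -> C)
    (rho : quat a b -> 'M[C]_2) : Prop :=
  forall c : k, rho c%:A = (tau c)%:M.

(* When rho extends an embedding of k into C, det (rho x) is the image of
   nrd x, so that elements of norm 1 are sent into SL(2, C). *)
Definition psl2_image (k : fieldType) (a b : k) (rho : quat a b -> 'M[C]_2)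
    (S : set (quat a b)) : set PSL2 :=
  psl2_proj @` (sl2_val @^-1` (rho @` S)).

Definition arithmetic_kleinian (H : set PSL2) : Prop :=
  kleinian H /\
  exists (k : fieldType) (a b : k) (tau : {rmorphism k -> C})
         (rho : {rmorphism quat a b -> 'M[C]_2}) (O : set (quat a b)),
    [/\ number_field k /\ one_complex_place k,
        a != 0 /\ b != 0,
        forall sigma : {rmorphism k -> R}, ramified_at sigma a b,
        [/\ complex_embedding tau, injective rho & extends_embedding tau rho]
      & is_order O /\ commensurable H (psl2_image rho (norm_one O))].

End Arithmetic.

(* Main.v *)
Require Import Defs.
From HB Require Import structures.
From mathcomp Require Import all_boot all_order all_algebra.
From mathcomp Require Import generic_quotient complex ring lra.
From mathcomp Require Import all_classical all_reals all_analysis.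

Set Implicit Arguments.
Unset Strict Implicit.
Unset Printing Implicit Defensive.

Import Order.TTheory GRing.Theory Num.Theory.
Import numFieldNormedType.Exports.

Local Open Scope classical_set_scope.
Local Open Scope ring_scope.

(** The candidate for the arithmetic Kleinian group is the image H in PSL(2, C)
    of the full group O^1 of elements of norm 1 of the order; G embeds in it.
    What has to be proved is that H is a discrete group, and that the data fit
    the definition of an arithmetic group.

    Arithmetic of k = Q(u, v) = Q(u). Since p has n - 2 real roots, its only
    other roots are u and its conjugate, and an embedding of k is determined by
    the root to which it sends u. So k has one complex place, and its real
    embeddings send u to some r_i; there u^2 - 1 and v^2 - 1 become negative, the
    norm form becomes positive definite, and the quaternion algebra is ramified
    ([embedding_eq], [one_complex_place_root], [ramified_definite]).

    Discreteness. Let x and y be distinct elements of O^1. The coordinates of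
    z = x - y have a common denominator N that depends on O only, so that N times
    a nonzero coordinate of z is a nonzero algebraic integer c of k, and the
    product of the values of c at all n embeddings is a nonzero rational integer
    ([norm_embeddings_ge1]). At each real embedding the definite norm form,
    equal to 1 at x and at y, bounds the coordinates of x and y, hence those of
    c ([definite_bound]). Therefore c cannot be small at the complex place
    ([norm_one_coord_separated]). As the coordinates of z at the complex place
    are linear in the matrix rho z, being trace forms ([qcoord_trace]), the
    matrices rho x and rho y are separated by a constant, which gives
    discreteness in PSL(2, C) ([norm_one_separated], [psl2_discrete]).

    Group. The inverse of x in O^1 is its conjugate t - x, t the reduced trace,
    and it lies in O once t is an algebraic integer. The eigenvalues of rho x are
    eigenvalues of the matrix of multiplication by x on generators of O, which
    has integral entries; so they and their sum t are integral
    ([order_eigenvalue], [order_conj]). *)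

(** * Algebraic integers and the norm of a number field *)

Lemma map_intr_morph (K L : nzRingType) (f : {rmorphism K -> L}) (p : {poly int}) :
  map_poly f (map_poly intr p) = map_poly intr p.
Proof.
rewrite -map_poly_comp; apply: eq_map_poly => z /=; exact: rmorph_int.
Qed.

Lemma map_ratr_morph (K L : fieldType) (f : {rmorphism K -> L}) (q : {poly rat}) :
  map_poly f (map_poly ratr q) = map_poly ratr q.
Proof.
have ratr0 (F : fieldType) : ratr 0 = 0 :> F by exact: (ratr_nat F 0).
by apply/polyP => i; rewrite coef_map !coef_map_id0 //= fmorph_rat.
Qed.

Lemma map_ratr_intr (K : numFieldType) (p : {poly int}) :
  map_poly (ratr : rat -> K) (map_poly intr p) = map_poly intr p.
Proof. exact: map_intr_morph. Qed.

Lemma integral_fmorph (K L : fieldType) (f : {rmorphism K -> L}) (x : K) :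
  integralOver (intr : int -> L) (f x) <-> integralOver (intr : int -> K) x.
Proof.
by split=> -[q qm qx]; exists q => //; move: qx;
  rewrite -(map_intr_morph f) fmorph_root.
Qed.

Lemma integral_prod (K : fieldType) (I : Type) (s : seq I) (F : I -> K) :
  (forall i, integralOver (intr : int -> K) (F i)) ->
  integralOver (intr : int -> K) (\prod_(i <- s) F i).
Proof.
move=> h; apply: big_ind => //; first exact: (integral1 intr).
exact: (@integral_mul _ _ intr).
Qed.

(** By the lemma of Gauss the factor 'X - x of a monic integral polynomial is
    proportional to an integral polynomial g dividing it in Z['X], and the
    leading coefficient of g is a unit of Z. *)
Lemma integral_rat_int (x : rat) :
  integralOver (intr : int -> rat) x -> exists z : int, x = z%:~R.
Proof.
case=> q qm qx.
have : 'X - x%:P %| map_poly intr q by rewrite dvdp_XsubCl.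
case/dvdpP_rat_int => g [d d0 eg] [h eh].
have lgh : lead_coef g * lead_coef h = 1 by rewrite -lead_coefM -eh (monicP qm).
have dl : d * (lead_coef g)%:~R = 1.
  have := congr1 lead_coef eg.
  by rewrite lead_coefXsubC lead_coefZ (lead_coef_map_inj (@intr_inj rat)).
have dE : d = (lead_coef h)%:~R.
  have gh : (lead_coef g)%:~R * (lead_coef h)%:~R = 1 :> rat by rewrite -intrM lgh.
  by rewrite -[LHS]mulr1 -[X in d * X]gh mulrA dl mul1r.
exists (- (lead_coef h * g`_0)).
have /(congr1 (fun r : {poly rat} => r`_0)) := eg.
rewrite coefB coefX coefC coefZ coef_map /= sub0r dE => /(canRL opprK) ->.
by rewrite intrN intrM.
Qed.

Section Norm.
Variables (k : fieldType) (K : numFieldType) (n : nat) (theta : k).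
Hypothesis theta_span : forall x : k,
  exists d : 'I_n -> rat, x = \sum_(j < n) ratr (d j) * theta ^+ j.
Variable sigma : 'I_n -> {rmorphism k -> K}.
Hypothesis sigma_inj : injective (fun l => sigma l theta).

(** The product is the determinant of the rational matrix A of multiplication by
    c on the powers of theta: the Vandermonde matrix of the conjugates of theta
    conjugates A into the diagonal matrix of the conjugates of c. *)
Lemma prod_embeddings_rat (c : k) : exists q : rat, \prod_l sigma l c = ratr q.
Proof.
have /choice[M hM] : forall i : 'I_n, exists d : 'I_n -> rat,
    c * theta ^+ i = \sum_(j < n) ratr (d j) * theta ^+ j.
  by move=> i; exact: theta_span.
pose A : 'M[rat]_n := \matrix_(i, j) M i j.
pose V := Vandermonde n (\row_l sigma l theta).
pose D : 'rV[K]_n := \row_l sigma l c.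
have AV : map_mx ratr A *m V = V *m diag_mx D.
  apply/matrixP => i l; rewrite mul_mx_diag !mxE.
  under eq_bigr => j _ do rewrite !mxE.
  rewrite -rmorphXn -rmorphM mulrC hM rmorph_sum; apply: eq_bigr => j _.
  by rewrite rmorphM rmorphXn fmorph_rat.
exists (\det A).
have V0 : \det V != 0.
  rewrite det_Vandermonde; apply/prodf_neq0 => i _; apply/prodf_neq0 => j ij.
  rewrite !mxE subr_eq0; apply: contraTneq ij => /sigma_inj ->.
  by rewrite ltnn.
have /(congr1 determinant) := AV.
rewrite !det_mulmx det_diag mulrC => /(mulfI V0).
rewrite det_map_mx => ->; apply: eq_bigr => l _.
by rewrite mxE.
Qed.

Lemma norm_embeddings_ge1 (c : k) :
  integralOver (intr : int -> k) c -> c != 0 -> 1 <= `|\prod_l sigma l c|.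
Proof.
move=> ic c0.
have [q qE] := prod_embeddings_rat c.
have iq : integralOver (intr : int -> rat) q.
  apply/(integral_fmorph (ratr : {rmorphism rat -> K})).
  rewrite /= -qE; apply: integral_prod => l; exact/integral_fmorph.
have [z zE] := integral_rat_int iq.
have z0 : z != 0.
  apply: contra_neq (_ : \prod_l sigma l c != 0) => [z0|].
    by rewrite qE zE z0 ratr_int.
  by apply/prodf_neq0 => l _; rewrite fmorph_eq0.
by rewrite qE zE ratr_int -intr_norm ler1z -gtz0_ge1 normr_gt0.
Qed.

End Norm.

(** The algebraic integers as a collective predicate, so that the closure lemmas
    for subrings apply to determinants and polynomials over them. *)
Definition algint (K : fieldType) : {pred K} :=
  fun z => `[< integralOver (intr : int -> K) z >].

Lemma algintP (K : fieldType) (z : K) :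
  reflect (integralOver (intr : int -> K) z) (z \in @algint K).
Proof. exact: asboolP. Qed.

Lemma algint_subring (K : fieldType) : subring_closed (@algint K).
Proof.
split=> [|x y /algintP hx /algintP hy|x y /algintP hx /algintP hy].
- by apply/algintP; exact: (integral1 intr).
- by apply/algintP; exact: (@integral_sub _ _ intr).
- by apply/algintP; exact: (@integral_mul _ _ intr).
Qed.

HB.instance Definition _ (K : fieldType) :=
  GRing.isSubringClosed.Build K (@algint K) (@algint_subring K).

Lemma char_poly_algint (K : fieldType) n (A : 'M[K]_n) :
  (forall i j, A i j \in @algint K) -> char_poly A \is a polyOver (@algint K).
Proof.
move=> hA; apply: rpred_sum => s _; apply: rpredM.
  by rewrite rpredX // rpredN rpred1.
apply: rpred_prod => i _; rewrite !mxE.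
by rewrite rpredB ?rpredMn ?polyOverX // polyOverC.
Qed.

Lemma eigenvalue_algint (K : fieldType) n (A : 'M[K]_n) (l : K) :
  (forall i j, A i j \in @algint K) -> eigenvalue A l -> l \in @algint K.
Proof.
move=> /char_poly_algint/polyOverP hA; rewrite eigenvalue_root_char => rl.
apply/algintP; apply: (integral_root_monic (char_poly_monic A) rl).
by apply/integral_poly => i; apply/algintP.
Qed.

Lemma trace_algint (K : closedFieldType) n (A : 'M[K]_n.+1) :
  (forall l, eigenvalue A l -> l \in @algint K) -> \tr A \in @algint K.
Proof.
move=> hA.
have [s es] := closed_field_poly_normal (char_poly A).
rewrite (monicP (char_poly_monic A)) scale1r in es.
have ss : size s = n.+1.
  by apply: succn_inj; rewrite -(size_char_poly A) es size_prod_XsubC.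
have := char_poly_trace A (ltn0Sn n).
rewrite es (_ : n.+1.-1 = (size s).-1); last by rewrite ss.
rewrite coefPn_prod_XsubC -?size_eq0 ?ss // => /oppr_inj <-.
rewrite big_seq; apply: rpred_sum => l ls; apply: hA.
by rewrite eigenvalue_root_char es root_prod_XsubC.
Qed.

(** * Orders as modules over the algebraic integers *)
Section OrderModule.
Variables (k : fieldType) (a b : k).
Local Notation Q := (quat a b).

Lemma quat_eq (x y : Q) :
  qre x = qre y -> qi x = qi y -> qj x = qj y -> qk x = qk y -> x = y.
Proof. by case: x y => ? ? ? ? [? ? ? ?] /= -> -> -> ->. Qed.

Definition qcoord (x : Q) (j : 'I_4) : k :=
  match nat_of_ord j with 0 => qre x | 1 => qi x | 2 => qj x | _ => qk x end.

Lemma qcoordD x y j : qcoord (x + y) j = qcoord x j + qcoord y j.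
Proof. by case: j => -[|[|[|[|]]]]. Qed.

Lemma qcoordB x y j : qcoord (x - y) j = qcoord x j - qcoord y j.
Proof. by case: j => -[|[|[|[|]]]]. Qed.

Lemma qcoordZ c x j : qcoord (c *: x) j = c * qcoord x j.
Proof. by case: j => -[|[|[|[|]]]]. Qed.

Lemma qcoord0 j : qcoord 0 j = 0.
Proof. by case: j => -[|[|[|[|]]]]. Qed.

Lemma qcoord_eq0 x : (forall j, qcoord x j = 0) -> x = 0.
Proof.
case: x => x0 x1 x2 x3 h.
have := h (inord 0); have := h (inord 1); have := h (inord 2).
by have := h (inord 3); rewrite /qcoord !inordK //= => -> -> -> ->.
Qed.

Variables (O : set Q) (O_order : is_order O).

Lemma orderB x y : O x -> O y -> O (x - y).
Proof.
case: O_order => -[m [e ->]] _ _ _ [c [ic ->]] [d [id ->]].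
exists (fun i => c i - d i); split => [i|].
  by apply: (@integral_sub _ _ intr).
by rewrite -sumrB; apply: eq_bigr => i _; rewrite scalerBl.
Qed.

Lemma orderZ c x : integralOver (intr : int -> k) c -> O x -> O (c *: x).
Proof.
move=> ic; case: O_order => -[m [e ->]] _ _ _ [d [id ->]].
exists (fun i => c * d i); split => [i|].
  by apply: (@integral_mul _ _ intr).
by rewrite scaler_sumr; apply: eq_bigr => i _; rewrite scalerA.
Qed.

Lemma orderN x : O x -> O (- x).
Proof.
move=> Ox; rewrite -scaleN1r; apply: orderZ => //.
by apply/algintP; rewrite rpredN rpred1.
Qed.

(** An order has finitely many generators over the ring of integers, so clearing
    the denominators of their coordinates suffices. *)
Lemma order_denominator :
  (forall x : k, exists2 N : int, N != 0 & N%:~R * x \in @algint k) ->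
  exists2 N : int, N != 0 & forall x, O x -> forall j, N%:~R * qcoord x j \in @algint k.
Proof.
move=> den; case: O_order => -[m [e ->]] _ _ _.
have /choice[f hf] : forall ij : 'I_m * 'I_4, exists N : int,
    N != 0 /\ N%:~R * qcoord (e ij.1) ij.2 \in @algint k.
  by move=> ij; have [N] := den (qcoord (e ij.1) ij.2); exists N.
exists (\prod_ij f ij) => [|x [c [ic ->]] j].
  by apply/prodf_neq0 => ij _; have [] := hf ij.
have -> : qcoord (\sum_i c i *: e i) j = \sum_i c i * qcoord (e i) j.
  rewrite (big_morph (fun x => qcoord x j) (fun x y => qcoordD x y j) (qcoord0 j)).
  by apply: eq_bigr => i _; rewrite qcoordZ.
rewrite mulr_sumr; apply: rpred_sum => i _.
rewrite mulrCA; apply: rpredM; first exact/algintP.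
rewrite (bigD1 (i, j)) //= mulrC intrM mulrA; apply: rpredM; last exact: rpred_int.
by rewrite mulrC; have [] := hf (i, j).
Qed.

End OrderModule.

(** * Matrix representations of a quaternion algebra *)
Section SplitQuaternion.
Variables (k : fieldType) (a b : k) (K : numFieldType).
Hypotheses (a_neq0 : a != 0) (b_neq0 : b != 0).
Local Notation Q := (quat a b).
Variables (tau : {rmorphism k -> K}) (rho : {rmorphism Q -> 'M[K]_2}).
Hypothesis rho_ext : forall c : k, rho c%:A = (tau c)%:M.

Lemma rhoZ c x : rho (c *: x) = tau c *: rho x.
Proof. by rewrite -[x in LHS]mul1r scalerAl rmorphM rho_ext; exact: mul_scalar_mx. Qed.

(** Each of i, j and ij anticommutes with an invertible quaternion, so that its
    matrix is similar to its opposite and has trace 0. *)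
Lemma trace_rho (x : Q) : \tr (rho x) = 2 * tau (qre x).
Proof.
pose I : Q := Quat 0 1 0 0; pose J : Q := Quat 0 0 1 0.
have self0 (y : K) : y = - y -> y = 0.
  by move/eqP; rewrite -addr_eq0 -mulr2n mulrn_eq0 => /eqP.
have trC y z : \tr (rho (y * z)) = \tr (rho (z * y)).
  by rewrite !rmorphM; exact: mxtrace_mulC.
have trZ c y : \tr (rho (c *: y)) = tau c * \tr (rho y).
  by rewrite rhoZ mxtraceZ.
have trN y : \tr (rho (- y)) = - \tr (rho y) by rewrite rmorphN raddfN.
have IJ : I * J = - (J * I) by rewrite quat_ij quat_ji opprK.
have trK : \tr (rho (I * J)) = 0 by apply: self0; rewrite {1}IJ trN trC.
have trI : \tr (rho I) = 0.
  apply/(mulfI (_ : tau b != 0)); rewrite ?fmorph_eq0 // mulr0 -trZ.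
  have -> : b *: I = I * J * J by rewrite -mulrA quat_jj -scalerAr mulr1.
  apply: self0; rewrite [X in \tr (rho X) = _](_ : _ = - (J * (I * J))).
    by rewrite trN trC.
  by rewrite mulrA -mulNr -IJ.
have trJ : \tr (rho J) = 0.
  apply/(mulfI (_ : tau a != 0)); rewrite ?fmorph_eq0 // mulr0 -trZ.
  have -> : a *: J = I * I * J by rewrite quat_ii -scalerAl mul1r.
  apply: self0; rewrite [X in \tr (rho X) = _](_ : _ = - (I * J * I)).
    by rewrite trN trC mulrA.
  by rewrite -!mulrA -mulrN -IJ.
have xE : x = (qre x)%:A + qi x *: I + qj x *: J + qk x *: (I * J).
  rewrite quat_ij; apply: quat_eq; rewrite /=; ring.
rewrite [in LHS]xE !rmorphD !mxtraceD !trZ trI trJ trK !mulr0 !addr0.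
by rewrite rmorph1 mxtrace1 mulrC.
Qed.

(** Up to a nonzero scalar each coordinate of x is the scalar part of the product
    of x with one of 1, i, j, ij. *)
Lemma qcoord_trace (j : 'I_4) :
  exists E : 'M[K]_2, forall x : Q, tau (qcoord x j) = \tr (rho x *m E).
Proof.
suff [y [w [w0 hw]]] : exists (y : Q) (w : k), w != 0 /\
    forall x, qcoord x j = w * qre (x * y).
  have t2 : (2 : K) != 0 by rewrite pnatr_eq0.
  exists ((2^-1 * tau w) *: rho y) => x.
  rewrite -scalemxAr mxtraceZ -[_ *m _]/(rho x * rho y) -rmorphM trace_rho.
  by rewrite mulrACA mulVf // mul1r hw rmorphM.
case: j => -[|[|[|[|//]]]] lj.
- exists 1, 1; split=> [|x]; first exact: oner_neq0.
  by rewrite mulr1 mul1r.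
- exists (Quat 0 1 0 0), a^-1; split=> [|x]; first by rewrite invr_eq0.
  by rewrite /= /qcoord /=; field.
- exists (Quat 0 0 1 0), b^-1; split=> [|x]; first by rewrite invr_eq0.
  by rewrite /= /qcoord /=; field.
- exists (Quat 0 0 0 1), (- (a * b))^-1; split=> [|x].
    by rewrite invr_eq0 oppr_eq0 mulf_neq0.
  by rewrite /= /qcoord /=; field; rewrite oppr_eq0 mulf_neq0.
Qed.

(** The way back from matrices to coordinates: a small matrix rho x forces small
    coordinates at the place tau. *)
Lemma qcoord_bound : exists2 B : K, 0 < B & forall (x : Q) (d : K),
  (forall l m, `|rho x l m| <= d) -> forall j, `|tau (qcoord x j)| <= B * d.
Proof.
have /choice[E hE] := qcoord_trace.
pose B j := \sum_l \sum_m `|E j m l|.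
have B0 j : 0 <= B j by apply: sumr_ge0 => l _; apply: sumr_ge0 => m _.
have sB0 : 0 <= \sum_j B j by apply: sumr_ge0.
exists (1 + \sum_j B j) => [|x d hd j]; first by rewrite ltr_pwDl.
have d0 : 0 <= d by exact: le_trans (hd 0 0).
apply: (@le_trans _ _ (B j * d)); last first.
  rewrite ler_wpM2r // (bigD1 j) //= addrA [1 + _]addrC -addrA lerDl.
  by rewrite addr_ge0 // sumr_ge0.
rewrite hE /mxtrace mulr_suml; apply: le_trans (ler_norm_sum _ _ _) _.
apply: ler_sum => l _; rewrite mxE mulr_suml.
apply: le_trans (ler_norm_sum _ _ _) _; apply: ler_sum => m _.
by rewrite normrM mulrC ler_wpM2l.
Qed.

Variables (O : set Q) (O_order : is_order O).

(** If w rho(x) = l w, the rows w rho(e_i), for generators e_i of the order, form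
    a matrix F with M F = l F, where M is the integral matrix of multiplication
    by x on the generators. F is nonzero because the e_i generate 1. Any nonzero
    column of F then exhibits l as an eigenvalue of M. *)
Lemma order_eigenvalue x l : O x -> eigenvalue (rho x) l -> l \in @algint K.
Proof.
have [[m [e OE]] _ O1 OM] := O_order => Ox /eigenvalueP[w wE w0].
have Oe i : O (e i).
  rewrite OE; exists (fun j => (j == i)%:R); split => [j|].
    by apply/algintP; exact: rpred_nat.
  rewrite (bigD1 i) //= eqxx scale1r big1 ?addr0 // => j /negPf ->.
  by rewrite scale0r.
have /choice[M hM] : forall i, exists c : 'I_m -> k,
    (forall j, integralOver (intr : int -> k) (c j)) /\ x * e i = \sum_j c j *: e j.
  by move=> i; have := OM _ _ Ox (Oe i); rewrite {1}OE.
have [c [_ c1]] : exists c : 'I_m -> k,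
    (forall j, integralOver (intr : int -> k) (c j)) /\ 1 = \sum_j c j *: e j.
  by have := O1; rewrite {1}OE.
pose F : 'M[K]_(m, 2) := \matrix_i (w *m rho (e i)).
have hF : map_mx tau (\matrix_(i, j) M i j) *m F = l *: F.
  apply/row_matrixP => i; rewrite row_mul linearZ /= rowK scalemxAl -wE -mulmxA.
  rewrite -[rho x *m _]/(rho x * rho (e i)) -rmorphM (hM i).2 rmorph_sum.
  rewrite mulmx_sumr mulmx_sum_row; apply: eq_bigr => j _.
  by rewrite rowK !mxE rhoZ scalemxAr.
have F0 : F != 0.
  apply: contraNneq w0 => F0.
  have -> : w = w *m rho 1 by rewrite rmorph1 mulmx1.
  rewrite c1 rmorph_sum mulmx_sumr big1 // => j _.
  rewrite rhoZ -scalemxAr -[w *m _](rowK (fun i => w *m rho (e i))) -/F.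
  by rewrite F0 row0 scaler0.
have [i [s Fis]] : exists i s, F i s != 0 by exact/matrix0Pn.
apply: (@eigenvalue_algint _ _ (map_mx tau (\matrix_(i, j) M i j))^T) => [p q|].
  by rewrite !mxE; apply/algintP/integral_fmorph; have [h _] := hM q; exact: h.
apply/eigenvalueP; exists (col s F)^T.
  by rewrite -trmx_mul colE mulmxA hF -scalemxAl linearZ.
apply: contraNneq Fis => /matrixP/(_ 0 i).
by rewrite !mxE => ->.
Qed.

End SplitQuaternion.

(** The conjugate of x is t - x, where t is the trace of rho x, an algebraic
    integer by [order_eigenvalue]. *)
Lemma order_conj (k : fieldType) (a b : k) (K : numClosedFieldType)
    (tau : {rmorphism k -> K}) (rho : {rmorphism quat a b -> 'M[K]_2})
    (O : set (quat a b)) :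
  a != 0 -> b != 0 -> (forall c : k, rho c%:A = (tau c)%:M) -> is_order O ->
  forall x, O x -> O (conjq x).
Proof.
move=> a0 b0 rho_ext OO x Ox; have [_ _ O1 _] := OO.
have -> : conjq x = (2 * qre x)%:A - x by apply: quat_eq; rewrite /=; ring.
apply: (orderB OO) => //; apply: (orderZ OO) => //.
apply/(integral_fmorph tau)/algintP.
rewrite rmorphM rmorph_nat -(trace_rho a0 b0 rho_ext).
by apply: trace_algint => l; exact: (order_eigenvalue rho_ext OO Ox).
Qed.

Lemma definite_terms_ge0 (R : realFieldType) (al be y1 y2 y3 : R) :
  al < 0 -> be < 0 ->
  [/\ 0 <= - al * y1 ^+ 2, 0 <= - be * y2 ^+ 2 & 0 <= al * be * y3 ^+ 2].
Proof.
move=> /ltW al0 /ltW be0.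
by split; apply: mulr_ge0; rewrite ?sqr_ge0 ?oppr_ge0 ?mulr_le0.
Qed.

(** * Real places where the norm form is definite *)
Section Definite.
Variables (k : fieldType) (a b : k) (R : realFieldType).
Variable sigma : {rmorphism k -> R}.
Hypotheses (a_lt0 : sigma a < 0) (b_lt0 : sigma b < 0).

Lemma sigma_nrd (x : quat a b) : sigma (nrd x) =
  sigma (qre x) ^+ 2 + - sigma a * sigma (qi x) ^+ 2
  + - sigma b * sigma (qj x) ^+ 2 + sigma a * sigma b * sigma (qk x) ^+ 2.
Proof. by rewrite /nrd !(rmorphB, rmorphD, rmorphM, rmorphXn) /= !mulNr. Qed.

(** At an element of norm 1 the four terms of the definite form are nonnegative
    and add up to 1, so that none exceeds 1. *)
Lemma definite_bound : exists2 B : R, 1 <= B &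
  forall x : quat a b, nrd x = 1 -> forall j, `|sigma (qcoord x j)| <= B.
Proof.
have na : 0 < - sigma a by rewrite oppr_gt0.
have nb : 0 < - sigma b by rewrite oppr_gt0.
have ab : 0 < sigma a * sigma b by rewrite -mulrNN mulr_gt0.
(* |y| <= max(1, y^2), and y^2 <= 1 / w. *)
have le_sqr (w y : R) : 0 < w -> w * y ^+ 2 <= 1 -> `|y| <= 1 + w^-1.
  move=> w0; rewrite mulrC -ler_pdivlMr // div1r -real_normK ?num_real // => h.
  have [y1|/ltW y1] := lerP `|y| 1; first by rewrite (le_trans y1) // lerDl invr_ge0 ltW.
  apply: le_trans (_ : `|y| ^+ 2 <= _); first by rewrite ler_eXnr.
  by rewrite (le_trans h) // lerDr.
exists (1 + (1 + (- sigma a)^-1 + (- sigma b)^-1 + (sigma a * sigma b)^-1)).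
  by rewrite lerDl !addr_ge0 ?invr_ge0 // ltW.
move=> x /(congr1 sigma); rewrite rmorph1 sigma_nrd.
set y0 := sigma (qre x); set y1 := sigma (qi x).
set y2 := sigma (qj x); set y3 := sigma (qk x) => e.
have p0 : 0 <= y0 ^+ 2 by rewrite sqr_ge0.
have [p1 p2 p3] := definite_terms_ge0 y1 y2 y3 a_lt0 b_lt0.
have ia : 0 <= (- sigma a)^-1 by rewrite invr_ge0 ltW.
have ib : 0 <= (- sigma b)^-1 by rewrite invr_ge0 ltW.
have iab : 0 <= (sigma a * sigma b)^-1 by rewrite invr_ge0 ltW.
have b0 : `|y0| <= 1 + 1^-1 by apply: le_sqr => //; lra.
have b1 : `|y1| <= 1 + (- sigma a)^-1 by apply: le_sqr => //; lra.
have b2 : `|y2| <= 1 + (- sigma b)^-1 by apply: le_sqr => //; lra.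
have b3 : `|y3| <= 1 + (sigma a * sigma b)^-1 by apply: le_sqr => //; lra.
rewrite invr1 in b0.
case=> -[|[|[|[|//]]]] lj; rewrite /qcoord /= -/y0 -/y1 -/y2 -/y3; lra.
Qed.

End Definite.

Lemma ramified_definite (k : fieldType) (a b : k) (R : realFieldType)
    (sigma : {rmorphism k -> R}) :
  sigma a < 0 -> sigma b < 0 -> ramified_at sigma a b.
Proof.
move=> a0 b0 x x0.
have n0 : nrd x != 0.
  apply: contra_neq x0; rewrite /nrd => e.
  have [p1 p2 p3] := definite_terms_ge0 (qi x) (qj x) (qk x) a0 b0.
  have p0 : 0 <= qre x ^+ 2 by rewrite sqr_ge0.
  have /eqP : qre x ^+ 2 = 0 by lra.
  have /eqP : - sigma a * qi x ^+ 2 = 0 by lra.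
  have /eqP : - sigma b * qj x ^+ 2 = 0 by lra.
  have /eqP : sigma a * sigma b * qk x ^+ 2 = 0 by lra.
  rewrite ![_ * _ ^+ 2 == 0]mulf_eq0 !sqrf_eq0 mulf_eq0 !oppr_eq0.
  rewrite (lt_eqF a0) (lt_eqF b0) /=.
  by move=> /eqP ? /eqP ? /eqP ? /eqP ?; apply: quat_eq.
have xC : x * conjq x = conjq x * x.
  by apply: quat_eq; rewrite /=; ring.
exists ((nrd x)^-1 *: conjq x).
by rewrite -scalerAr -scalerAl -xC nrdE scalerA mulVf // scale1r.
Qed.

(** * Uniform separation of the elements of norm 1 *)
Section Separation.
Variables (R : rcfType) (k : fieldType) (m : nat) (theta : k).
Local Notation C := R[i].
Hypothesis theta_span : forall x : k,
  exists d : 'I_m.+2 -> rat, x = \sum_(j < m.+2) ratr (d j) * theta ^+ j.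
Hypothesis theta_int : integralOver (intr : int -> k) theta.
Variables (tau : {rmorphism k -> C}) (sigma : 'I_m -> {rmorphism k -> R}).
Hypothesis tau_theta : tau theta \isn't Num.real.
Hypothesis sigma_inj : injective (fun i => sigma i theta).

(** The embeddings tau, its conjugate and the sigma i have distinct values at
    theta, and there are as many of them as powers of theta that span k: they
    play the part of all the embeddings in [norm_embeddings_ge1]. *)
Lemma norm_places_ge1 (c : k) : integralOver (intr : int -> k) c -> c != 0 ->
  1 <= `|tau c| ^+ 2 * \prod_i (`|sigma i c|)%:C%C.
Proof.
move=> ic c0.
pose f0 : {rmorphism k -> C} := Num.conj \o tau.
pose fr i : {rmorphism k -> C} := real_complex R \o sigma i.
(* The embeddings in the order tau, conjugate of tau, sigma 0, sigma 1, ... *)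
pose F (l : 'I_m.+2) : {rmorphism k -> C} :=
  if unlift ord0 l is Some l' then
    if unlift ord0 l' is Some i then fr i else f0
  else tau.
have F0 : F ord0 = tau by rewrite /F unlift_none.
have F1 : F (lift ord0 ord0) = f0 by rewrite /F liftK unlift_none.
have F2 i : F (lift ord0 (lift ord0 i)) = fr i by rewrite /F !liftK.
have realC (y : R) : (y%:C)%C \is Num.real by rewrite complex_real.
have F_inj : injective (fun l => F l theta).
  have tf0 : tau theta != f0 theta.
    by apply: contra tau_theta => /eqP e; rewrite CrealE /= -[X in X == _]/(f0 theta) -e.
  have tfr i : tau theta != fr i theta.
    by apply: contraNneq tau_theta => ->; exact: realC.
  have ffr i : f0 theta != fr i theta.
    apply: contraNneq tau_theta => e.
    by rewrite -[tau theta]conjCK -[(tau theta)^*]/(f0 theta) e conj_Creal ?realC.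
  move=> l l'.
  case: (unliftP ord0 l) => [l1|] ->; case: (unliftP ord0 l') => [l1'|] ->;
    rewrite ?F0 //.
  - case: (unliftP ord0 l1) => [i|] ->; case: (unliftP ord0 l1') => [i'|] ->;
      rewrite ?F1 ?F2 // => /eqP.
    + by move=> /eqP/= [] /sigma_inj ->.
    + by rewrite eq_sym (negPf (ffr _)).
    + by rewrite (negPf (ffr _)).
  - case: (unliftP ord0 l1) => [i|] ->; rewrite ?F1 ?F2 => /eqP.
    + by rewrite eq_sym (negPf (tfr _)).
    + by rewrite eq_sym (negPf tf0).
  - case: (unliftP ord0 l1') => [i|] ->; rewrite ?F1 ?F2 => /eqP.
    + by rewrite (negPf (tfr _)).
    + by rewrite (negPf tf0).
have := norm_embeddings_ge1 theta_span F_inj ic c0.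
rewrite !big_ord_recl F0 F1 !normrM mulrA norm_conjC -expr2 normr_prod.
by under eq_bigr => i _ do rewrite F2 /= normc_def /= expr0n /= addr0 sqrtr_sqr.
Qed.

Lemma algint_denominator (x : k) : exists2 N : int, N != 0 & N%:~R * x \in @algint k.
Proof.
have intr_neq0 (z : int) : z != 0 -> z%:~R != 0 :> k.
  by move=> z0; rewrite -(fmorph_eq0 tau) rmorph_int intr_eq0.
have [d ->] := theta_span x.
exists (\prod_j denq (d j)) => [|].
  by apply/prodf_neq0 => j _; exact: denq_neq0.
rewrite mulr_sumr; apply: rpred_sum => j _.
rewrite (bigD1 j) //= intrM mulrACA; apply: rpredM.
  by rewrite /ratr mulrC divfK ?rpred_int // intr_neq0 ?denq_neq0.
by apply: rpredM; [exact: rpred_int | apply: rpredX; exact/algintP].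
Qed.

Variables (a b : k) (O : set (quat a b)) (O_order : is_order O).
Hypotheses (sigma_a : forall i, sigma i a < 0) (sigma_b : forall i, sigma i b < 0).

(** For a nonzero coordinate z_j of z = x - y, the algebraic integer c = N z_j
    satisfies 1 <= |tau c|^2 P, where P = prod_i 2 |N| B_i bounds the product of
    the values of c at the real places. As P >= 1, it follows that
    1 <= |tau c| P = |N| P |tau z_j|. *)
Lemma norm_one_coord_separated : exists2 e : C, 0 < e & forall x y : quat a b,
  norm_one O x -> norm_one O y -> x != y -> exists j, e <= `|tau (qcoord (x - y) j)|.
Proof.
have [N N0 hN] := order_denominator O_order algint_denominator.
have /choice[B hB] : forall i, exists B : R, 1 <= B /\
    forall x : quat a b, nrd x = 1 -> forall j, `|sigma i (qcoord x j)| <= B.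
  by move=> i; have [B] := definite_bound (sigma_a i) (sigma_b i); exists B.
have N1 (K : numDomainType) : 1 <= `|N%:~R| :> K.
  by rewrite -intr_norm ler1z -gtz0_ge1 normr_gt0.
pose F i : R := `|N%:~R| * (B i + B i).
pose P : C := \prod_i (F i)%:C%C.
have F1 i : 1 <= F i.
  have [B1 _] := hB i; rewrite -[1]mulr1; apply: ler_pM => //.
  by rewrite (le_trans B1) // lerDl (le_trans _ B1).
have P1 : 1 <= P.
  apply: (big_ind (fun z : C => 1 <= z)) => // [z w|i _]; first exact: mulr_ege1.
  by rewrite -(rmorph1 (real_complex R)) lecR.
have P0 : 0 < P by exact: lt_le_trans P1.
have NP0 : 0 < `|N%:~R| * P by rewrite mulr_gt0 // (lt_le_trans _ (N1 _)).
exists (`|N%:~R| * P)^-1 => [|x y [Ox nx] [Oy ny] xy]; first by rewrite invr_gt0.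
have [j zj] : exists j, qcoord (x - y) j != 0.
  apply: contrapT => h; move/eqP: xy; apply; apply/eqP; rewrite -subr_eq0; apply/eqP.
  by apply: qcoord_eq0 => j; apply/eqP/negPn/negP => zj; apply: h; exists j.
exists j; set z := qcoord (x - y) j in zj *.
have c0 : N%:~R * z != 0.
  by rewrite mulf_neq0 // -(fmorph_eq0 tau) rmorph_int intr_eq0.
have /algintP ic := hN _ (orderB O_order Ox Oy) j.
have := norm_places_ge1 ic c0.
rewrite -/z rmorphM rmorph_int normrM => h.
rewrite -[X in X <= _]mulr1 ler_pdivrMl //.
have u0 : 0 <= `|N%:~R| * P * `|tau z| by rewrite mulr_ge0 // ltW.
rewrite -(expr_ge1 (isT : (0 < 2)%N) u0); apply: le_trans h _.
have -> : `|N%:~R| * P * `|tau z| = `|N%:~R| * `|tau z| * P by rewrite mulrAC.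
rewrite [X in _ <= X]exprMn; apply: ler_wpM2l; first by rewrite exprn_ge0 // mulr_ge0.
apply: (@le_trans _ _ P); last by rewrite ler_eXnr.
apply: ler_prod => i _; rewrite !lecR normr_ge0 /=.
rewrite rmorphM rmorph_int normrM ler_wpM2l // /z qcoordB rmorphB.
by rewrite (le_trans (ler_normB _ _)) // lerD // (hB i).2.
Qed.

Hypotheses (a_neq0 : a != 0) (b_neq0 : b != 0).
Variable rho : {rmorphism quat a b -> 'M[C]_2}.
Hypothesis rho_ext : forall c : k, rho c%:A = (tau c)%:M.

(** Matrices that are close have close coordinates at tau, by [qcoord_bound]. *)
Lemma norm_one_separated : exists2 d : C, 0 < d & forall x y : quat a b,
  norm_one O x -> norm_one O y ->
  (forall l m, `|rho x l m - rho y l m| <= d) -> x = y.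
Proof.
have [e e0 he] := norm_one_coord_separated.
have [B B0 hB] := qcoord_bound a_neq0 b_neq0 rho_ext.
(* Half of e, because the two bounds on the coordinate are both weak inequalities. *)
exists (e / 2 / B); first by rewrite !divr_gt0.
move=> x y Ox Oy h; apply/eqP/negPn/negP => xy.
have [j ej] := he _ _ Ox Oy xy.
suff : e < e by rewrite ltxx.
apply: le_lt_trans ej _; apply: le_lt_trans (hB (x - y) (e / 2 / B) _ j) _ => [l p|].
  by rewrite rmorphB !mxE.
by rewrite mulrC divfK ?gt_eqF // ltr_pdivrMr // ltr_pMr // ltr1n.
Qed.

End Separation.

(** * Subgroups of PSL(2, C) *)

Section PSL2Discrete.
Variable R : realType.
Local Notation C := R[i].

(** The neighbourhood of the class of A is the image of the ball of radius d at
    A. It is open since its preimage V is the union of that ball and its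
    opposite, and it contains the class of B only if B or - B is in the ball. *)
Lemma psl2_discrete (M : set 'M[C]_2) (d : C) : 0 < d ->
  (forall A, M A -> M (- A)) ->
  (forall A B, M A -> M B -> (forall i j, `|A i j - B i j| <= d) -> A = B) ->
  discrete_subset (@psl2_proj R @` (@sl2_val R @^-1` M)).
Proof.
move=> d0 MN sep g [A /= MA gA].
have MpM (B : SL2 R) : (@psl2_proj R @` (@sl2_val R @^-1` M)) (psl2_proj B) ->
    M (sl2_val B).
  case=> B' MB' /psl2_projP/orP[] /eqP e; first by rewrite -e.
  by rewrite -[sl2_val B]opprK -e; exact: MN.
split; first by apply/mem_set; exists A.
pose U : set 'M[C^o]_2 := ball (sl2_val A : 'M[C^o]_2) d.
pose V : set 'M[C^o]_2 := U `|` -%R @^-1` U.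
pose W : set (PSL2 R) := [set h | exists2 B : SL2 R, V (sl2_val B) & psl2_proj B = h].
have VN B : V B -> V (- B).
  by case=> h; [right; rewrite /= opprK | left].
have WV B : W (psl2_proj B) -> V (sl2_val B).
  case=> B' VB' /psl2_projP/orP[] /eqP e; first by rewrite -e.
  by rewrite -[sl2_val B]opprK -e; exact: VN.
have oV : open V.
  have oU : open U by exact: ball_open.
  by apply: openU => //; apply: open_comp => // B _; exact: opp_continuous.
have oW : open W.
  have -> : open W = open ((@psl2_proj R) @^-1` W) by [].
  exists V => //; apply/seteqP; split=> B /=; last exact: WV.
  by move=> VB; exists B.
exists W.
  apply: open_nbhs_nbhs; split => //; exists A => //; left; exact: ballxx.
have close (B : SL2 R) : M (sl2_val B) -> U (sl2_val B) -> sl2_val A = sl2_val B.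
  move=> MB [_ UB]; apply: sep => // i j; apply: ltW; exact: UB.
apply/seteqP; split=> [h [Wh Mh]|h ->]; last first.
  split; last by exists A.
  by exists A => //; left; exact: ballxx.
elim/psl2_ind: h Wh Mh => B WB /MpM MB.
rewrite -gA; apply/esym/psl2_projP/orP.
case: (WV _ WB) => UB; [left|right]; apply/eqP; first exact: close.
have NB : \det (- sl2_val B) == 1.
  by rewrite -scaleN1r detZ sqrrN expr1n mul1r; exact: sl2_valP.
exact: (close (MkSL2 NB) (MN _ MB) UB).
Qed.

Lemma discrete_subset_sub (T : topologicalType) (H K : set T) :
  H `<=` K -> discrete_subset K -> discrete_subset H.
Proof.
move=> HK dK x Hx; have [_ [V nV VK]] := dK x (HK x Hx).
split; first exact/mem_set.
exists V => //; apply/seteqP; split=> [y [Vy Hy]|y ->].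
  by rewrite -VK; split => //; exact: HK.
by split => //; exact: nbhs_singleton.
Qed.

Lemma psl2_image_subgroup (k : fieldType) (a b : k)
    (rho : {rmorphism quat a b -> 'M[C]_2}) (G : set (quat a b)) :
  mul_group G -> is_subgroup (psl2_image rho G).
Proof.
move=> [G1 GM GV]; split.
  by exists 1%g => //=; exists 1 => //; rewrite rmorph1.
move=> g h [A [x Gx xA] <-] [B [y Gy yB] <-].
have [y' Gy' [yy' y'y]] := GV y Gy.
exists (A * B^-1)%g; last by rewrite /= -psl2_mulE -psl2_invE.
exists (x * y'); first exact: GM.
rewrite rmorphM /= xA; congr (_ *m _).
apply: (can_inj (mulKmx (sl2_unitmx B))); rewrite mulmxV ?sl2_unitmx //.
by rewrite -yB -[_ *m _]/(rho y * rho y') -rmorphM yy' rmorph1.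
Qed.

Lemma commensurable_refl (gT : groupType) (H : set gT) :
  is_subgroup H -> commensurable H H.
Proof.
move=> [H1 HB]; suff h : finite_index (H `&` H) H by [].
have HV x : H x -> H x^-1%g by move=> Hx; rewrite -[x^-1%g]mul1g; exact: HB.
have HM x y : H x -> H y -> H (x * y)%g.
  by move=> Hx Hy; rewrite -[y]invgK; apply: HB => //; exact: HV.
apply: (@sub_finite_set _ _ [set H]); last exact: finite_set1.
move=> _ [g Hg <-] /=; rewrite setIid; apply/seteqP; split=> [_ [h Hh <-]|h Hh].
  exact: HM.
by exists (g^-1 * h)%g; [apply: HM => //; exact: HV | rewrite mulVKg].
Qed.

End PSL2Discrete.

(** * Embeddings of a simple extension of the rationals *)

(** Conjugate numbers have the same rational relations: by a Bezout identity, a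
    rational polynomial vanishing at one root of p is a multiple of p. *)
Lemma root_transfer (F K : numFieldType) (p q : {poly rat}) (x : F) (y : K) :
  irreducible_poly p -> root (map_poly ratr p) x -> root (map_poly ratr p) y ->
  root (map_poly ratr q) x -> root (map_poly ratr q) y.
Proof.
move=> p_irr px py qx; have [/dvdpP[g ->]|pq] := boolP (p %| q).
  by rewrite rmorphM rootM py orbT.
have /Bezout_eq1_coprimepP[[g h] /= e] : coprimep p q.
  by rewrite irreducible_poly_coprime.
have /eqP := congr1 (fun f => (map_poly (ratr : rat -> F) f).[x]) e.
rewrite rmorphD !rmorphM rmorph1 hornerD !hornerM (rootP px) (rootP qx).
by rewrite !mulr0 addr0 hornerC eq_sym oner_eq0.
Qed.

(** The values at u of rational polynomials are already closed under division: a
    Bezout identity between p and g gives the inverse of g(u). *)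
Lemma adjoin_root_poly (F : numFieldType) (p : {poly rat}) (u z : F) :
  irreducible_poly p -> root (map_poly ratr p) u -> z \in adjoin [:: u] ->
  exists q : {poly rat}, z = (map_poly ratr q).[u].
Proof.
move=> p_irr pu /asboolP adj.
pose S : {pred F} := fun z => `[< exists q : {poly rat}, z = (map_poly ratr q).[u] >].
have SP w : reflect (exists q : {poly rat}, w = (map_poly ratr q).[u]) (w \in S).
  exact: asboolP.
suff /adj : divring_closed S.
  move=> zS; suff /zS /SP : {subset [:: u] <= S} by [].
  move=> w; rewrite mem_seq1 => /eqP ->; apply/SP; exists 'X.
  by rewrite map_polyX hornerX.
split=> [|x y /SP[f ->] /SP[g ->]|x y /SP[f ->] /SP[g ->]];
  apply/SP.
- by exists 1; rewrite rmorph1 hornerC.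
- by exists (f - g); rewrite rmorphB hornerD hornerN.
have [->|g0] := eqVneq (map_poly ratr g).[u] 0.
  by exists 0; rewrite invr0 mulr0 rmorph0 horner0.
have /Bezout_eq1_coprimepP[[s t] /= e] : coprimep p g.
  rewrite irreducible_poly_coprime //; apply: contra_neqN g0 => /dvdpP[h ->].
  by rewrite rmorphM hornerM (rootP pu) mulr0.
have := congr1 (fun f => (map_poly (ratr : rat -> F) f).[u]) e.
rewrite rmorphD !rmorphM rmorph1 hornerD !hornerM (rootP pu) mulr0 add0r hornerC => tg.
exists (f * t); rewrite rmorphM hornerM; congr (_ * _).
by rewrite -[LHS]mul1r -tg mulfK.
Qed.

Lemma horner_modp_root (F : numFieldType) (p q : {poly rat}) (u : F) n :
  root (map_poly ratr p) u -> size p = n.+1 ->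
  (map_poly ratr q).[u] = \sum_(j < n) ratr (q %% p)`_j * u ^+ j.
Proof.
move=> pu sp; rewrite {1}(divp_eq q p) rmorphD rmorphM hornerD hornerM (rootP pu).
rewrite mulr0 add0r (@horner_coef_wide _ n).
  by apply: eq_bigr => j _; rewrite coef_map.
by rewrite size_map_poly -ltnS -sp ltn_modp -size_poly_eq0 sp.
Qed.

Lemma adjoin_sub (F : fieldType) (s t : seq F) :
  {subset s <= adjoin t} -> {subset adjoin s <= adjoin t}.
Proof. by move=> st z /asboolP; apply => //; exact: adjoin_closed. Qed.

Lemma mem_adjoin (F : fieldType) (s : seq F) (x : F) : x \in s -> x \in adjoin s.
Proof. by move=> xs; apply/asboolP => S _; apply. Qed.

Section AdjoinInclusion.
Variables (F : fieldType) (s t : seq F) (st : {subset s <= adjoin t}).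

Definition adjoin_incl (x : adjoin_field s) : adjoin_field t :=
  AdjoinField (adjoin_sub st (adjoin_valP x)).

Fact adjoin_incl_zmod : zmod_morphism adjoin_incl.
Proof. by move=> x y; apply: val_inj. Qed.
Fact adjoin_incl_monoid : monoid_morphism adjoin_incl.
Proof. by split=> [|x y]; apply: val_inj. Qed.

HB.instance Definition _ :=
  GRing.isZmodMorphism.Build _ _ adjoin_incl adjoin_incl_zmod.
HB.instance Definition _ :=
  GRing.isMonoidMorphism.Build _ _ adjoin_incl adjoin_incl_monoid.
End AdjoinInclusion.

Section Embeddings.
Variables (k : fieldType) (n : nat) (theta : k) (F : numFieldType).
Variable tau : {rmorphism k -> F}.
Hypothesis theta_span : forall x : k,
  exists d : 'I_n -> rat, x = \sum_(j < n) ratr (d j) * theta ^+ j.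

Lemma embedding_eq (K : fieldType) (f g : {rmorphism k -> K}) :
  f theta = g theta -> f =1 g.
Proof.
move=> fg x; have [d ->] := theta_span x; rewrite !rmorph_sum; apply: eq_bigr => j _.
by rewrite [LHS]rmorphM [RHS]rmorphM !fmorph_rat !rmorphXn /= fg.
Qed.

(** Send the value of q at theta to the value of q at y; [root_transfer] makes
    this independent of the choice of q, hence a morphism. *)
Lemma embedding_exists (K : numFieldType) (p : {poly rat}) (y : K) :
  irreducible_poly p -> root (map_poly ratr p) (tau theta) ->
  root (map_poly ratr p) y ->
  exists f : {rmorphism k -> K}, f theta = y.
Proof.
move=> p_irr pt py.
have /choice[q hq] : forall x, exists q : {poly rat},
    tau x = (map_poly ratr q).[tau theta].
  move=> x; have [d ->] := theta_span x.
  exists (\sum_(j < n) (d j)%:P * 'X^j).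
  rewrite rmorph_sum /= [map_poly _ _]rmorph_sum horner_sum; apply: eq_bigr => j _.
  rewrite [LHS]rmorphM fmorph_rat rmorphXn rmorphM hornerM /= map_polyC hornerC.
  by rewrite map_polyXn hornerXn.
have tr (g : {poly rat}) :
    (map_poly ratr g).[tau theta] = 0 -> (map_poly ratr g).[y] = 0.
  by move=> gt; apply/rootP; apply: (root_transfer p_irr pt py); exact/rootP.
pose f x := (map_poly (ratr : rat -> K) (q x)).[y].
have fB : zmod_morphism f.
  move=> x z; apply/eqP; rewrite -subr_eq0 /f; apply/eqP.
  have := tr (q (x - z) - (q x - q z)).
  rewrite !rmorphB /= !hornerE; apply.
  by rewrite -!hq rmorphB subrr.
have fM : monoid_morphism f.
  split=> [|x z]; apply/eqP; rewrite -subr_eq0 /f; apply/eqP.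
    have := tr (q 1 - 1); rewrite !rmorphB !rmorph1 /= !hornerE; apply.
    by rewrite -hq rmorph1 subrr.
  have := tr (q (x * z) - q x * q z).
  rewrite !rmorphB !rmorphM /= !hornerE; apply.
  by rewrite -!hq rmorphM subrr.
pose f' : {rmorphism k -> K} := HB.pack f
  (GRing.isZmodMorphism.Build _ _ f fB) (GRing.isMonoidMorphism.Build _ _ f fM).
exists f'; apply/eqP; rewrite -subr_eq0 /= /f; apply/eqP.
have := tr (q theta - 'X).
rewrite !rmorphB /= map_polyX !hornerE map_polyX hornerX; apply.
by rewrite -hq subrr.
Qed.

End Embeddings.

(** * The norm one group of an order *)

Section NormOne.
Variables (R : realType) (k : fieldType) (m : nat) (theta : k).
Local Notation C := R[i].
Hypothesis theta_span : forall x : k,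
  exists d : 'I_m.+2 -> rat, x = \sum_(j < m.+2) ratr (d j) * theta ^+ j.
Hypothesis theta_int : integralOver (intr : int -> k) theta.
Variables (tau : {rmorphism k -> C}) (sigma : 'I_m -> {rmorphism k -> R}).
Hypothesis tau_theta : tau theta \isn't Num.real.
Hypothesis sigma_inj : injective (fun i => sigma i theta).
Variables (a b : k) (O : set (quat a b)) (O_order : is_order O).
Hypotheses (sigma_a : forall i, sigma i a < 0) (sigma_b : forall i, sigma i b < 0).
Hypotheses (a_neq0 : a != 0) (b_neq0 : b != 0).
Variable rho : {rmorphism quat a b -> 'M[C]_2}.
Hypothesis rho_ext : extends_embedding tau rho.

Lemma norm_one_group : mul_group (norm_one O).
Proof.
have [_ _ O1 OM] := O_order.
have cK (x : quat a b) : conjq (conjq x) = x by apply: quat_eq; rewrite /= ?opprK.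
have nC (x : quat a b) : nrd (conjq x) = nrd x by rewrite /nrd /=; ring.
have inv (x : quat a b) : nrd x = 1 -> x * conjq x = 1.
  by move=> nx; rewrite nrdE nx scale1r.
split=> [|x y [Ox nx] [Oy ny]|x [Ox nx]].
- by split=> //; rewrite /nrd /=; ring.
- split; first exact: OM.
  have -> : nrd (x * y) = nrd x * nrd y by rewrite /nrd /=; ring.
  by rewrite nx ny mulr1.
- exists (conjq x).
    by split; [exact: (order_conj a_neq0 b_neq0 rho_ext) | rewrite nC].
  by split; [|rewrite -{2}[x]cK]; apply: inv; rewrite ?nC.
Qed.

Lemma norm_one_discrete : discrete_subset (psl2_image rho (norm_one O)).
Proof.
have [d d0 sep] := norm_one_separated theta_span theta_int tau_theta sigma_inj
  O_order sigma_a sigma_b a_neq0 b_neq0 rho_ext.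
apply: (psl2_discrete d0) => [_ [x [Ox nx] <-]|_ _ [x Nx <-] [y Ny <-] h].
  exists (- x); last by rewrite rmorphN.
  by split; [exact: orderN | rewrite -nx /nrd /=; ring].
by rewrite (sep x y).
Qed.

End NormOne.

Lemma rat_span_number_field (k : fieldType) (F : numFieldType) (tau : {rmorphism k -> F})
    (n : nat) (theta : k) :
  (forall x : k, exists d : 'I_n -> rat, x = \sum_(j < n) ratr (d j) * theta ^+ j) ->
  number_field k.
Proof.
move=> span; split; last by exists n, (fun j => theta ^+ j).
by move=> q; rewrite -(fmorph_pchar tau); exact: pchar_num.
Qed.

Section OneComplexPlace.
Variables (R : realType) (k : fieldType) (n : nat) (theta : k) (p : {poly rat}).
Local Notation C := R[i].
Hypothesis theta_span : forall x : k,
  exists d : 'I_n -> rat, x = \sum_(j < n) ratr (d j) * theta ^+ j.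
Variable tau : {rmorphism k -> C}.
Hypothesis p_theta : root (map_poly ratr p) (tau theta).
Hypothesis tau_theta : tau theta \isn't Num.real.
Hypothesis p_roots : forall z : C, root (map_poly ratr p) z -> z \isn't Num.real ->
  z = tau theta \/ z = (tau theta)^*.

(** An embedding sends theta to a root of p. At a nonreal root it agrees with tau
    or its conjugate; at a real root it agrees with its own conjugate, so all its
    values are real. *)
Lemma one_complex_place_root : one_complex_place R k.
Proof.
exists tau; first by exists theta.
move=> tau' [x tx].
have pt' : root (map_poly ratr p) (tau' theta).
  have pt : (map_poly ratr p).[theta] = 0.
    apply: (fmorph_inj tau); rewrite rmorph0 -horner_map map_ratr_morph.
    exact/rootP.
  by apply/rootP; rewrite -(map_ratr_morph tau') horner_map pt rmorph0.
have [tr|tr] := boolP (tau' theta \is Num.real); last first.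
  case: (p_roots pt' tr) => e; [left|right] => y.
    exact: (embedding_eq theta_span).
  exact: (@embedding_eq _ _ _ theta_span _ tau' (Num.conj \o tau)).
case/negP: tx; rewrite CrealE; apply/eqP.
apply: (@embedding_eq _ _ _ theta_span _ (Num.conj \o tau') tau' _ x).
exact: conj_Creal.
Qed.

End OneComplexPlace.

(** * Nonreal roots of an integral polynomial *)

Section NonRealRoots.
Variables (R : rcfType) (p : {poly int}) (u : R[i]).
Hypotheses (p_neq0 : p != 0) (p_u : root (map_poly intr p) u).
Hypothesis u_nonreal : u \isn't Num.real.

Lemma conj_neq : u != u^*.
Proof. by rewrite eq_sym -CrealE. Qed.

Lemma root_conj : root (map_poly intr p) u^*.
Proof. by rewrite -(map_intr_morph Num.conj) fmorph_root. Qed.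

Lemma root_real_complex (x : R) :
  root (map_poly intr p) x%:C%C = root (map_poly intr p) x.
Proof. by rewrite -(map_intr_morph (real_complex R)) fmorph_root. Qed.

Lemma count_roots (s : seq R) (w : seq R[i]) :
  uniq s -> all (root (map_poly intr p)) s ->
  uniq w -> all (root (map_poly intr p)) w -> all (fun z => z \isn't Num.real) w ->
  (size w + size s < size p)%N.
Proof.
move=> us rs uw rw nw.
have pC0 : map_poly intr p != 0 :> {poly R[i]}.
  by rewrite map_poly_eq0_id0 ?intr_eq0 ?lead_coef_eq0.
have sp : size (map_poly intr p : {poly R[i]}) = size p.
  by rewrite size_map_inj_poly //; exact: intr_inj.
rewrite -sp -(size_map (real_complex R) s) -size_cat.
apply: max_poly_roots => //.
  rewrite all_cat rw all_map; apply: sub_all rs => x /=.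
  by rewrite root_real_complex.
rewrite cat_uniq uw map_inj_uniq ?us ?andbT //=; last exact: complexI.
apply/hasPn => _ /mapP[x _ ->]; apply/negP => /(allP nw).
by rewrite complex_real eqxx.
Qed.

(** A further nonreal root z would make size s + 3 distinct roots, together with
    u, its conjugate and the real roots of s. *)
Lemma nonreal_root_eq (s : seq R) (z : R[i]) :
  uniq s -> all (root (map_poly intr p)) s -> (size p <= size s + 3)%N ->
  root (map_poly intr p) z -> z \isn't Num.real -> z = u \/ z = u^*.
Proof.
move=> us rs sp rz nz.
have [->|zu] := eqVneq z u; first by left.
have [->|zu'] := eqVneq z u^*; first by right.
have := @count_roots s [:: z; u; u^*] us rs.
rewrite /= !inE negb_or zu zu' rz p_u root_conj nz u_nonreal /= !andbT.
rewrite conj_neq.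
have -> : u^* \isn't Num.real by rewrite CrealE conjCK conj_neq.
by move=> /(_ isT isT isT); rewrite addnC ltnNge sp.
Qed.

Lemma nonreal_root_size : (2 < size p)%N.
Proof.
have := @count_roots [::] [:: u; u^*] isT isT.
rewrite /= !inE p_u root_conj u_nonreal /= !andbT.
rewrite conj_neq.
have -> : u^* \isn't Num.real by rewrite CrealE conjCK conj_neq.
by move=> /(_ isT isT isT).
Qed.

End NonRealRoots.

(** * Quaternion algebras from a root with real conjugates in (-1, 1) *)
Theorem corollary9p1 (R : realType) (n : nat) (p : {poly int})
  (r : (n - 2).-tuple R) (u v : R[i])
  (p_monic : p \is monic)
  (p_irr : irreducible_poly (map_poly intr p : {poly rat}))
  (p_deg : size p = n.+1)
  (p_u : root (map_poly intr p) u)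
  (u_nonreal : u \isn't Num.real)
  (r_uniq : uniq r)
  (r_roots : forall x : R, root (map_poly intr p) x <-> x \in r)
  (r_bound : forall i : 'I_(n - 2), -1 < tnth r i < 1)
  (v_in : v \in adjoin [:: u])
  (v_int : integralOver (intr : int -> R[i]) v)
  (v_sqr : v ^+ 2 != 1)
  (v_bound : forall (i : 'I_(n - 2)) (sigma : {rmorphism adjoin_field [:: u] -> R}),
     sigma (adjoin_gen [:: u] ord0) = tnth r i ->
     -1 < sigma (AdjoinField v_in) < 1)
  (a := adjoin_gen [:: u; v] ord0 ^+ 2 - 1)
  (b := adjoin_gen [:: u; v] ord_max ^+ 2 - 1)
  (O G : set (quat a b))
  (rho : {rmorphism quat a b -> 'M[R[i]]_2})
  (rho_inj : injective rho)
  (rho_ext : extends_embedding (adjoin_val [:: u; v]) rho)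
  (O_order : is_order O)
  (G_sub : G `<=` norm_one O)
  (G_group : mul_group G) :
  exists H : set (PSL2 R),
    [/\ arithmetic_kleinian H,
        is_subgroup (psl2_image rho G),
        psl2_image rho G `<=` H
      & discrete_subset (psl2_image rho G)].
Proof.
pose k := adjoin_field [:: u; v].
pose tau : {rmorphism k -> R[i]} := (val : k -> R[i]).
pose theta : k := adjoin_gen [:: u; v] ord0.
pose P : {poly rat} := map_poly intr p.
have PE (K : numFieldType) : map_poly ratr P = map_poly intr p :> {poly K}.
  exact: map_ratr_intr.
have P_u : root (map_poly ratr P) u by rewrite PE.
have p_neq0 : p != 0 by rewrite -size_poly_gt0 p_deg.
have P_size : size P = n.+1 by rewrite size_map_inj_poly //; exact: intr_inj.
have r_all : all (root (map_poly intr p)) r by apply/allP => x /r_roots.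
have nE : n = (n - 2).+2.
  have := nonreal_root_size p_neq0 p_u u_nonreal.
  by rewrite p_deg; case: (n) => [|[|m]] //; rewrite !subSS subn0.
have u_adj : {subset [:: u] <= adjoin [:: u; v]}.
  by move=> z; rewrite mem_seq1 => /eqP ->; apply: mem_adjoin; rewrite mem_head.
have uv_adj : {subset [:: u; v] <= adjoin [:: u]}.
  move=> z; rewrite in_cons mem_seq1 => /orP[] /eqP -> //.
  by apply: mem_adjoin; rewrite mem_head.
(* All of k = Q(u, v) is Q(u), so theta = u is a primitive element. *)
have span x : exists d : 'I_(n - 2).+2 -> rat,
    x = \sum_(j < (n - 2).+2) ratr (d j) * theta ^+ j.
  have [q xq] := adjoin_root_poly p_irr P_u (adjoin_sub uv_adj (adjoin_valP x)).
  exists (fun j => (q %% P)`_j); apply: (fmorph_inj tau).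
  rewrite [RHS]rmorph_sum -[LHS]/(adjoin_val _ x) xq.
  rewrite (horner_modp_root _ P_u (etrans P_size (congr1 S nE))); apply: eq_bigr => j _.
  by rewrite [RHS]rmorphM fmorph_rat rmorphXn.
have theta_int : integralOver (intr : int -> k) theta.
  by apply/(integral_fmorph tau); exists p.
(* A real embedding f of k restricts to one of Q(u), sending u to some r_i. *)
have extend (f : {rmorphism k -> R}) : f a < 0 /\ f b < 0.
  have fr : f theta \in r.
    apply/r_roots; rewrite -(map_intr_morph f).
    rewrite fmorph_root -(fmorph_root tau) map_intr_morph.
    exact: p_u.
  have /tnthP[i fi] := fr.
  pose incl : {rmorphism adjoin_field [:: u] -> k} := adjoin_incl u_adj.
  pose g : {rmorphism adjoin_field [:: u] -> R} := f \o incl.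
  have g_theta : g (adjoin_gen [:: u] ord0) = f theta.
    by congr (f _); apply: val_inj.
  have g_v : g (AdjoinField v_in) = f (adjoin_gen [:: u; v] ord_max).
    by congr (f _); apply: val_inj.
  have := v_bound i g (etrans g_theta fi); rewrite g_v => vb.
  have := r_bound i; rewrite -fi => ub.
  have lt0 (x : R) : -1 < x < 1 -> x ^+ 2 - 1 < 0.
    by move=> /andP[x1 x2]; rewrite subr_sqr_1 nmulr_rlt0 ?subr_lt0 // -ltrBlDr sub0r.
  by rewrite /a /b !rmorphB !rmorphXn !rmorph1; split; exact: lt0.
have /choice[sigma sigmaE] : forall i : 'I_(n - 2),
    exists f : {rmorphism k -> R}, f theta = tnth r i.
  move=> i; apply: (@embedding_exists _ _ theta _ tau span _ P) => //.
  by rewrite PE; apply/r_roots; exact: mem_tnth.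
have sigma_inj : injective (fun i => sigma i theta).
  by move=> i j /=; rewrite !sigmaE; apply/tuple_uniqP.
have a_neq0 : a != 0.
  rewrite -(fmorph_eq0 tau) rmorphB rmorphXn rmorph1 subr_eq0.
  apply: contra u_nonreal; rewrite sqrf_eq1 => /orP[] /eqP /= ->.
    exact: real1.
  by rewrite realN real1.
have b_neq0 : b != 0.
  by rewrite -(fmorph_eq0 tau) rmorphB rmorphXn rmorph1 subr_eq0.
have sigma_a i := (extend (sigma i)).1.
have sigma_b i := (extend (sigma i)).2.
have O1_group : mul_group (norm_one O).
  by apply: (norm_one_group O_order a_neq0 b_neq0 (tau := tau)) rho_ext.
have discr := norm_one_discrete span theta_int (u_nonreal : tau theta \isn't Num.real)
  sigma_inj O_order sigma_a sigma_b a_neq0 b_neq0 rho_ext.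
have H_group := psl2_image_subgroup rho O1_group.
have GH : psl2_image rho G `<=` psl2_image rho (norm_one O).
  by apply: image_subset; apply: preimage_subset; exact: image_subset.
exists (psl2_image rho (norm_one O)); split => //.
- split=> //; exists k, a, b, tau, rho, O; split=> //.
  + split; first exact: (rat_span_number_field tau span).
    apply: (@one_complex_place_root R k _ theta P span tau) => // z.
    rewrite PE => rz nz; apply: (@nonreal_root_eq _ p u p_neq0 p_u u_nonreal r) => //.
    by rewrite size_tuple p_deg addn3 [X in (X < _)%N]nE.
  + by move=> f; have [fa fb] := extend f; exact: ramified_definite.
  + by split=> //; exists theta.
  + by split=> //; exact: commensurable_refl.
- exact: psl2_image_subgroup.
- exact: discrete_subset_sub GH discr.
Qed.
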